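(* Let $d, K \ge 1$ be integers and $\sigma > 0$. Let $u_1, \dots, u_K$ be independent random vectors in $\mathbb{R}^d$ with $u_k \sim \mathcal{N}(0, \Sigma_k)$, where each $\Sigma_k \in \mathbb{R}^{d\times d}$ is symmetric positive semidefinite (possibly singular), and let $z$ be the random vector which takes the value $u_k$ with probability $\pi_k > 0$, where $\sum_{k=1}^K \pi_k = 1$ (the random index being chosen independently of $u_1,\dots,u_K$). Let $w \sim \mathcal{N}(0, I_d)$ be independent of $z$ (and of the random index), let $x \doteq z + \sigma w$, and let $x \mapsto q(x)$ be the density of this random vector on $\mathbb{R}^d$. Define $$M_k \doteq (\Sigma_k + \sigma^2 I_d)^{-1/2}, \qquad k = 1,\dots,K,$$ and assume that $\pi_i \det(M_i) = \pi_j \det(M_j)$ for all $1 \le i \le j \le K$. Then for every $x \in \mathbb{R}^d$, $$\nabla_x \log q(x) = -\begin{bmatrix} M_1, \cdots, M_K \end{bmatrix} \left[ \operatorname{diag}\left( \operatorname{softmax}\left( -\frac{1}{2} \begin{bmatrix} \|M_1^* x\|_2^2 \\ \vdots \\ \|M_K^* x\|_2^2 \end{bmatrix} \right)\right) \otimes I_d \right] \begin{bmatrix} M_1^* x \\ \vdots \\ M_K^* x \end{bmatrix}.$$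
   Context: $A^*$ denotes the transpose of a real matrix $A$. For a symmetric positive definite matrix $A$, $A^{-1/2}$ is the inverse of its symmetric positive definite square root. For $v \in \mathbb{R}^K$, $\operatorname{softmax}(v) \in \mathbb{R}^K$ is the vector with $k$-th entry $e^{v_k} / \sum_{i=1}^K e^{v_i}$, and $\operatorname{diag}(v)$ is the $K\times K$ diagonal matrix with diagonal $v$. $\otimes$ denotes the Kronecker product, i.e. $A \otimes B$ is the block matrix whose $(i,j)$ block is $A_{ij} B$. $[M_1,\cdots,M_K] \in \mathbb{R}^{d \times dK}$ is the horizontal concatenation, and the last factor is the vertical concatenation in $\mathbb{R}^{dK}$ of the vectors $M_k^* x$. *)

(* Defs.v *)
From HB Require Import structures.
From mathcomp Require Import all_boot all_order all_algebra.
From mathcomp Require Import all_classical all_reals all_analysis.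
From mathcomp.real_closed Require Export mxtens.

Set Implicit Arguments.
Unset Strict Implicit.
Unset Printing Implicit Defensive.

Import Order.TTheory GRing.Theory Num.Theory.
Import numFieldNormedType.Exports.

Local Open Scope classical_set_scope.
Local Open Scope ring_scope.

Definition matrix_display : measure_display.
Proof. exact: default_measure_display. Qed.

(* The product sigma-algebra, generated by the entries; it coincides with the
   Borel sigma-algebra of 'M[R]_(m, n). *)
Section measurable_matrix.
Context (R : realType) (m n : nat).

Definition entry_preimages : set (set 'M[R]_(m, n)) :=
  \bigcup_ij preimage_set_system setT
    (fun A : 'M[R]_(m, n) => A ij.1 ij.2) measurable.

HB.instance Definition _ := @isMeasurable.Build matrix_display
  'M[R]_(m, n) <<s entry_preimages >>
  (@sigma_algebra0 _ setT entry_preimages)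
  (@sigma_algebraC _ entry_preimages)
  (@sigma_algebra_bigcup _ setT entry_preimages).

Lemma measurable_entry i j : measurable_fun setT (fun A : 'M[R]_(m, n) => A i j).
Proof.
move=> _ Y mY; apply: sub_sigma_algebra.
by exists (i, j) => //; exists Y.
Qed.

Lemma measurable_fun_mxP d (T : measurableType d) (f : T -> 'M[R]_(m, n)) :
  measurable_fun setT f <-> forall i j, measurable_fun setT (fun t => f t i j).
Proof.
split=> [mf i j|mf].
  exact: (measurableT_comp (@measurable_entry i j) mf).
apply: (@measurability _ _ _ _ _ _ entry_preimages) => //.
move=> _ [_ [[i j] _ [Y mY <-]] <-].
by rewrite !setTI; have := mf i j measurableT Y mY; rewrite setTI.
Qed.

End measurable_matrix.

Section lebesgue_cV.
Context {R : realType}.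

Definition cons_cV n (x : R * 'cV[R]_n) : 'cV[R]_n.+1 := col_mx x.1%:M x.2.

Definition uncons_cV n (v : 'cV[R]_n.+1) : R * 'cV[R]_n :=
  (v ord0 ord0, \col_i v (lift ord0 i) ord0).

Lemma cons_cV0 n (x : R * 'cV[R]_n) : cons_cV x ord0 ord0 = x.1.
Proof.
rewrite /cons_cV (_ : ord0 = lshift n (ord0 : 'I_1)); last exact: val_inj.
by rewrite (@col_mxEu _ 1 n 1) mxE.
Qed.

Lemma cons_cV_lift n (x : R * 'cV[R]_n) i :
  cons_cV x (lift ord0 i) ord0 = x.2 i ord0.
Proof.
rewrite /cons_cV (_ : lift ord0 i = rshift 1 i); last exact: val_inj.
by rewrite (@col_mxEd _ 1 n 1).
Qed.

Lemma cons_cVK n : cancel (@cons_cV n) (@uncons_cV n).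
Proof.
move=> [t v]; rewrite /uncons_cV cons_cV0; congr pair.
by apply/colP => i; rewrite mxE cons_cV_lift.
Qed.

Lemma uncons_cVK n : cancel (@uncons_cV n) (@cons_cV n).
Proof.
move=> v; apply/colP => i; have [j ->|->] := unliftP ord0 i.
  by rewrite cons_cV_lift mxE.
by rewrite cons_cV0.
Qed.

Lemma measurable_cons_cV n : measurable_fun setT (@cons_cV n).
Proof.
apply/measurable_fun_mxP => i j; rewrite [j]ord1.
have [k ->|->] := unliftP ord0 i.
- rewrite (_ : (fun _ => _) = (fun v : 'cV[R]_n => v k ord0) \o snd); last first.
    by apply/funext => x /=; rewrite cons_cV_lift.
  exact: measurableT_comp (@measurable_entry R n 1 k ord0) measurable_snd.
- rewrite (_ : (fun _ => _) = fst) //.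
  by apply/funext => x /=; rewrite cons_cV0.
Qed.

Lemma measurable_uncons_cV n : measurable_fun setT (@uncons_cV n).
Proof.
apply/measurable_fun_pairP; split=> /=.
  exact: measurable_entry.
apply/measurable_fun_mxP => i j.
rewrite (_ : (fun _ => _) = (fun v : 'cV[R]_n.+1 => v (lift ord0 i) ord0)).
  exact: measurable_entry.
by apply/funext => v /=; rewrite mxE.
Qed.

Section step.
Context (n : nat) (mu : {sigma_finite_measure set 'cV[R]_n -> \bar R}).

Definition lebesgue_step : set 'cV[R]_n.+1 -> \bar R :=
  pushforward (@lebesgue_measure R \x mu)%E (@cons_cV n).

Let lebesgue_step0 : lebesgue_step set0 = 0%E.
Proof. by rewrite /lebesgue_step /pushforward preimage_set0 measure0. Qed.

Let lebesgue_step_ge0 A : (0 <= lebesgue_step A)%E.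
Proof. by rewrite /lebesgue_step /pushforward. Qed.

Let lebesgue_step_sigma_additive : semi_sigma_additive lebesgue_step.
Proof.
have mpre A : measurable A -> measurable (@cons_cV n @^-1` A).
  by move=> mA; rewrite -[X in measurable X]setTI; exact: measurable_cons_cV.
move=> F mF tF mUF; rewrite /lebesgue_step /pushforward preimage_bigcup.
apply: measure_semi_sigma_additive.
- by move=> k; exact: mpre.
- apply/trivIsetP => /= i j _ _ ij; rewrite -preimage_setI.
  by move/trivIsetP : tF => /(_ _ _ _ _ ij) ->//; rewrite preimage_set0.
- by rewrite -preimage_bigcup; exact: mpre.
Qed.

HB.instance Definition _ := isMeasure.Build _ _ _ lebesgue_step
  lebesgue_step0 lebesgue_step_ge0 lebesgue_step_sigma_additive.

Let lebR : {sigma_finite_measure set (measurableTypeR R) -> \bar R} :=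
  lebesgue_measure.

Let lebesgue_step_sigma_finite : sigma_finite setT lebesgue_step.
Proof.
have /sigma_finiteP[F [FT ndF Foo]] := sigma_finiteT lebR.
have /sigma_finiteP[G [GT ndG Goo]] := sigma_finiteT mu.
exists (fun k => @uncons_cV n @^-1` (F k `*` G k)).
  apply/esym; rewrite -subTset => v _ /=.
  have [k _ Fk] : (\bigcup_i F i) (uncons_cV v).1 by rewrite -FT.
  have [l _ Gl] : (\bigcup_i G i) (uncons_cV v).2 by rewrite -GT.
  exists (maxn k l) => //; split.
  - by move: Fk; exact/subsetPset/ndF/leq_maxl.
  - by move: Gl; exact/subsetPset/ndG/leq_maxr.
move=> k; have [mF Fk] := Foo k; have [mG Gk] := Goo k; split.
  rewrite -[X in measurable X]setTI; apply: measurable_uncons_cV => //.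
  exact: measurableX.
rewrite /lebesgue_step /pushforward -comp_preimage.
rewrite (_ : _ \o _ = id); last by apply/funext => x /=; rewrite cons_cVK.
rewrite preimage_id product_measure1E// lte_mul_pinfty// ge0_fin_numE//.
Qed.

HB.instance Definition _ := Measure_isSigmaFinite.Build _ _ _ lebesgue_step
  lebesgue_step_sigma_finite.

End step.

(* Lebesgue measure on R^n as an iterated product; see lebesgue_cV_box. *)
Fixpoint lebesgue_cV (n : nat) : {sigma_finite_measure set 'cV[R]_n -> \bar R} :=
  match n with
  | 0 => \d_(0 : 'cV[R]_0)
  | n'.+1 => lebesgue_step (lebesgue_cV n')
  end.

Lemma lebesgue_cV_box n (A : 'I_n -> set R) : (forall i, measurable (A i)) ->
  lebesgue_cV n [set v : 'cV[R]_n | forall i, A i (v i ord0)] =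
  (\prod_(i < n) lebesgue_measure (A i))%E.
Proof.
elim: n A => [|n IHn] A mA.
  by rewrite big_ord0 /= diracE mem_set//= => -[].
rewrite big_ord_recl -(IHn (fun i => A (lift ord0 i)))//=.
rewrite /lebesgue_step /pushforward.
rewrite (_ : _ @^-1` _ = A ord0 `*`
    [set v : 'cV[R]_n | forall i, A (lift ord0 i) (v i ord0)]); last first.
  apply/seteqP; split => [x /= Ax|x /= [Ax0 Ax] i].
    split; first by have := Ax ord0; rewrite cons_cV0.
    by move=> i; have := Ax (lift ord0 i); rewrite cons_cV_lift.
  by have [j ->|->] := unliftP ord0 i; rewrite ?cons_cV0 ?cons_cV_lift.
pose B := [set v : 'cV[R]_n | forall i, A (lift ord0 i) (v i ord0)].
suff mB : measurable B.
  by rewrite product_measure1E; [|exact: mA|exact: mB].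
rewrite (_ : B =
    \bigcap_(i : 'I_n) ((fun v : 'cV[R]_n => v i ord0) @^-1` A (lift ord0 i))).
  apply: fin_bigcap_measurable => // i _.
  by rewrite -[X in measurable X]setTI; exact: measurable_entry.
by apply/seteqP; split => [v Bv i _|v Bv i]; exact: Bv.
Qed.

End lebesgue_cV.

Section independence.
Context d (T : measurableType d) (R : realType) (P : probability T R).
Local Open Scope ereal_scope.

Definition indep2 (F G : set (set T)) : Prop :=
  forall A B, F A -> G B -> P (A `&` B) = P A * P B.

Definition mutually_indep (I : finType) (F : I -> set (set T)) : Prop :=
  forall (J : {set I}) (A : I -> set T), (forall i, i \in J -> F i (A i)) ->
    P (\bigcap_(i in [set` J]) A i) = \prod_(i in J) P (A i).

Definition sigma_of d' (T' : measurableType d') (X : T -> T') : set (set T) :=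
  preimage_set_system setT X measurable.

(* The finite codomain I carries the discrete sigma-algebra. *)
Definition sigma_of_index (I : finType) (X : T -> I) : set (set T) :=
  preimage_set_system setT X setT.

Definition sigma_of_family (I : finType) d' (T' : measurableType d')
    (X : I -> T -> T') : set (set T) :=
  <<s \bigcup_i sigma_of (X i) >>.

End independence.

Section linear_algebra.
Context {R : realType}.

Definition psdmx n (A : 'M[R]_n) : Prop :=
  A^T = A /\ forall v : 'cV[R]_n, 0 <= (v^T *m A *m v) ord0 ord0.

Definition pdmx n (A : 'M[R]_n) : Prop :=
  A^T = A /\ forall v : 'cV[R]_n, v != 0 -> 0 < (v^T *m A *m v) ord0 ord0.

(* M = A^(-1/2): the positive definite square root S of A is unique and exists
   iff A is positive definite, hence the relational form. *)
Definition is_inv_sqrtmx n (A M : 'M[R]_n) : Prop :=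
  exists S : 'M[R]_n, [/\ pdmx S, S *m S = A & M = invmx S].

Definition norm2 n (v : 'cV[R]_n) : R := Num.sqrt (\sum_(i < n) v i ord0 ^+ 2).

Definition softmax n (v : 'cV[R]_n) : 'cV[R]_n :=
  \col_k (expR (v k ord0) / \sum_(i < n) expR (v i ord0)).

(* Same index convention as *t: column k * n + j of hconcat M (resp. row
   k * m + i of vconcat M) is column j (resp. row i) of M k. *)
Definition hconcat m n K (M : 'I_K -> 'M[R]_(m, n)) : 'M[R]_(m, K * n) :=
  \matrix_(i, j) M (mxtens_unindex j).1 i (mxtens_unindex j).2.

Definition vconcat m n K (M : 'I_K -> 'M[R]_(m, n)) : 'M[R]_(K * m, n) :=
  \matrix_(i, j) M (mxtens_unindex i).1 (mxtens_unindex i).2 j.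

Definition gradient n (f : 'cV[R]_n -> R) (x : 'cV[R]_n) : 'cV[R]_n :=
  \col_i 'D_(delta_mx i ord0) f x.

End linear_algebra.

Section gaussian.
Context {R : realType}.

(* N(0, I_n), through its density with respect to Lebesgue measure. *)
Definition std_gaussian n (A : set 'cV[R]_n) : \bar R :=
  (\int[lebesgue_cV n]_(g in A) (\prod_(i < n) normal_pdf 0 1 (g i ord0))%:E)%E.

Context d (T : measurableType d) (P : probability T R).

(* X ~ N(0, Sigma), i.e. X has the law of Sigma^(1/2) g with g ~ N(0, I_n);
   Sigma may be singular. *)
Definition is_gaussian n (Sigma : 'M[R]_n) (X : T -> 'cV[R]_n) : Prop :=
  exists S : 'M[R]_n, [/\ psdmx S, S *m S = Sigma &
    forall A, measurable A -> P (X @^-1` A) = std_gaussian (mulmx S @^-1` A)].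

(* A density is only determined almost everywhere; continuity makes the values
   q y meaningful, since there is at most one continuous density. *)
Definition is_continuous_density n (X : T -> 'cV[R]_n) (q : 'cV[R]_n -> R) :
    Prop :=
  [/\ continuous q, forall y, 0 <= q y &
    forall A, measurable A ->
      P (X @^-1` A) = (\int[lebesgue_cV n]_(y in A) (q y)%:E)%E].

End gaussian.

(* Main.v *)
(* Each [u k] has the law of [S g] with [g] standard Gaussian and [S] the square
   root of [Sigma k], so [u k + sigma w] has at [y] the density
   [int sigma^-n phi((y - S g) / sigma) phi(g) dg].  Completing the square in
   [g] turns the integrand into a Gaussian with Hessian
   [sigma^-2 (Sigma k + sigma^2 I)] times [exp(- |M k y|^2 / 2)]; the Gaussian integral is computed by integrating one
   coordinate at a time and passing to the Schur complement, which avoids any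
   matrix change of variables.  As [Sigma k] may be singular, [u k] need not have
   a density; only [w] is changed of variables, to [y = S g + sigma w].
   Hence [q] is almost everywhere, and by continuity everywhere, a constant times
   [\sum_k exp(- |M k y|^2 / 2)], the weights [pi_ k * \det (M k)] being equal.
   Its logarithmic gradient is the softmax average of the [- M k (M k)^T x]. *)
From HB Require Import structures.
Require Import Defs.
From mathcomp Require Import all_boot all_order all_algebra.
From mathcomp Require Import all_classical all_reals all_analysis.
From mathcomp Require Import measurable_realfun ring lra.

Import Order.TTheory GRing.Theory Num.Theory.
Import numFieldNormedType.Exports.

Local Open Scope classical_set_scope.
Local Open Scope ring_scope.

Set Implicit Arguments.
Unset Strict Implicit.
Unset Printing Implicit Defensive.

(** * Gaussian integrals over column vectors *)

Section positive_definite.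
Context {R : realType}.

(** Completing the square in the scalar coordinate [t]; what remains of the form depends on [v]
    alone, through the Schur complement of [b]. *)
Lemma schur_form n (b : R) (c : 'cV[R]_n) (D : 'M[R]_n) (t : R) (v : 'cV[R]_n) :
  b != 0 ->
  ((col_mx t%:M v)^T *m block_mx b%:M c^T c D *m col_mx t%:M v) ord0 ord0 =
  b * (t + b^-1 * (c^T *m v) ord0 ord0) ^+ 2 +
  (v^T *m (D - b^-1 *: (c *m c^T)) *m v) ord0 ord0.
Proof.
move=> b0; rewrite tr_col_mx mul_row_block mul_row_col tr_scalar_mx.
have vc : v^T *m c = (c^T *m v)^T by rewrite trmx_mul trmxK.
rewrite mulmxBr mulmxBl -scalemxAr -scalemxAl !mulmxDl !mulmxA.
(* The matrix [c^T *m v] is 1 by 1; naming its entry [a] reduces the claim to an identity between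
   scalars. *)
rewrite vc -(mulmxA _ c^T v) -(mulmxA (_ *m _)^T c^T v); set m := c^T *m v.
rewrite [m]mx11_scalar; set a := m _ _.
rewrite tr_scalar_mx -!scalar_mxM !mxE /= !mulr1n.
by field.
Qed.

(** One step of block elimination: the lower triangular factor has unit diagonal, hence determinant
    1. *)
Lemma schur_det n (b : R) (c : 'cV[R]_n) (D : 'M[R]_n) : b != 0 ->
  \det (block_mx b%:M c^T c D) = b * \det (D - b^-1 *: (c *m c^T)).
Proof.
move=> b0.
have -> : block_mx b%:M c^T c D =
    block_mx 1%:M 0 (b^-1 *: c) 1%:M *m
    block_mx b%:M c^T 0 (D - b^-1 *: (c *m c^T)).
  rewrite mulmx_block !mul1mx !mul0mx !addr0 mul_mx_scalar scalerA.
  by rewrite divff// scale1r -scalemxAl addrC subrK.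
by rewrite det_mulmx det_lblock det_ublock !det1 det_scalar expr1 !mul1r.
Qed.

(** The induction step for positive definite matrices: peeling off the first coordinate leaves a
    positive definite matrix of smaller size. *)
Lemma pdmx_schur n (B : 'M[R]_n.+1) : pdmx B ->
  exists (b : R) (c : 'cV[R]_n) (D : 'M[R]_n),
  [/\ B = block_mx b%:M c^T c D, 0 < b &
      pdmx (D - b^-1 *: (c *m c^T))].
Proof.
rewrite -[B](@submxK _ 1 n 1 n) => -[Bs Bp].
move: Bs Bp; set D := drsubmx _; set c := dlsubmx _; set r := ursubmx _.
rewrite [ulsubmx _]mx11_scalar; set b := ulsubmx _ _ _ => Bs Bp.
have [rE DE] : r = c^T /\ D^T = D.
  move: Bs; rewrite (@tr_block_mx _ 1 n 1 n) => /(@eq_block_mx _ 1 n 1 n)[_ _ + ->].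
  by move=> <-; rewrite trmxK.
rewrite rE in Bs Bp *; exists b, c, D.
have {}Bp (v : 'cV[R]_(1 + n)) : v != 0 ->
    0 < (v^T *m block_mx b%:M c^T c D *m v) ord0 ord0 by exact: Bp.
have b0 : 0 < b.
  (* Testing on the first basis vector isolates the corner entry. *)
  have := Bp (col_mx 1%:M 0 : 'cV[R]_(1 + n)).
  rewrite tr_col_mx mul_row_block mul_row_col.
  rewrite trmx0 !mul0mx !mulmx0 !addr0 tr_scalar_mx mul1mx mulmx1 mxE mulr1n.
  apply; apply/eqP => /(congr1 (fun M => usubmx (M : 'M[R]_(1 + n, 1)) ord0 ord0)).
  by rewrite col_mxKu !mxE eqxx => /eqP; rewrite oner_eq0.
split => //; split.
  by rewrite linearB linearZ /= trmx_mul trmxK DE.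
(* The first coordinate is the minimiser of the form for this [v]: it makes the square in
   [schur_form] vanish. *)
move=> v v0; have := Bp (col_mx (- (b^-1 * (c^T *m v) ord0 ord0))%:M v : 'cV[R]_(1 + n)).
rewrite schur_form ?gt_eqF// addNr expr0n mulr0 add0r; apply.
apply: contra v0 => /eqP/(congr1 (fun M => dsubmx (M : 'M[R]_(1 + n, 1)))).
by rewrite col_mxKd => ->; rewrite linear0.
Qed.

Lemma pdmx_det_gt0 n (B : 'M[R]_n) : pdmx B -> 0 < \det B.
Proof.
elim: n B => [|n IHn] B; first by rewrite det_mx00 ltr01.
move=> /pdmx_schur[b [c [D [-> b0 /IHn CD]]]].
by rewrite (@schur_det _ b c D) ?gt_eqF// mulr_gt0.
Qed.

(** The integrand is the normal density of mean [- m] and variance [b^-1], divided by its peak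
    value; the density integrates to 1. *)
Lemma integral_gaussian_fun (b m : R) : 0 < b ->
  (\int[lebesgue_measure]_t (expR (- 2^-1 * (b * (t + m) ^+ 2)))%:E =
   (Num.sqrt (2 * pi) / Num.sqrt b)%:E)%E.
Proof.
move=> b0; pose s := (Num.sqrt b)^-1.
have s0 : 0 < s by rewrite invr_gt0 sqrtr_gt0.
have s2 : s ^+ 2 = b^-1 by rewrite exprVn sqr_sqrtr// ltW.
have pE : normal_peak s = (Num.sqrt (2 * pi) / Num.sqrt b)^-1.
  rewrite /normal_peak s2 -mulrnAr -mulr_natl sqrtrM ?invr_ge0 ?ltW//.
  by rewrite sqrtrV ?ltW// mulrC.
have p0 : 0 < normal_peak s by rewrite normal_peak_gt0// gt_eqF.
have := integral_normal_pdf (- m) s; rewrite normal_pdfE ?gt_eqF//.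
under eq_integral do rewrite EFinM.
rewrite ge0_integralZl//; last 3 first.
- by apply/measurable_EFinP; exact: measurable_normal_fun.
- by move=> t _; rewrite lee_fin normal_fun_ge0.
- by rewrite lee_fin ltW.
move=> /(congr1 (fun x => ((normal_peak s)^-1)%:E * x)%E).
rewrite muleA -EFinM mulVf ?gt_eqF// mul1e mule1 pE invrK => <-.
apply: eq_integral => t _; congr (expR _)%:E.
by rewrite s2 opprK; field; rewrite gt_eqF.
Qed.

End positive_definite.

Section lebesgue_cV_integral.
Context {R : realType}.
Local Open Scope ereal_scope.

Lemma measurable_comp_cons_cV n (F : 'cV[R]_n.+1 -> \bar R) :
  measurable_fun setT F ->
  measurable_fun setT (fun x : measurableTypeR R * 'cV[R]_n => F (cons_cV x)).
Proof.
move=> mF; apply: (@measurableT_comp _ _ _ _ _ _ F) => //.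
exact: measurable_cons_cV.
Qed.

(** Tonelli, in the order that integrates the first coordinate innermost, as the Schur recursion
    requires. *)
Lemma integral_lebesgue_cVS n (F : 'cV[R]_n.+1 -> \bar R) :
  (forall v, 0 <= F v) -> measurable_fun setT F ->
  \int[lebesgue_cV n.+1]_v F v =
  \int[lebesgue_cV n]_v \int[lebesgue_measure]_t F (cons_cV (t, v)).
Proof.
move=> F0 mF; rewrite /= /lebesgue_step.
rewrite ge0_integral_pushforward//; last exact: measurable_cons_cV.
have mFc := measurable_comp_cons_cV mF.
have Fc0 x : 0 <= (F \o @cons_cV R n) x by exact: F0.
by rewrite preimage_setT fubini_tonelli1// fubini_tonelli.
Qed.

Lemma measurable_integral_cons_cV n (F : 'cV[R]_n.+1 -> \bar R) :
  (forall v, 0 <= F v) -> measurable_fun setT F ->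
  measurable_fun setT
    (fun v : 'cV[R]_n => \int[lebesgue_measure]_t F (cons_cV (t, v))).
Proof.
move=> F0 mF; have mFc := measurable_comp_cons_cV mF.
by apply: (measurable_fun_fubini_tonelli_G _ mFc) => x; exact: F0.
Qed.

Lemma integral_lebesgue_cV0 (F : 'cV[R]_0 -> \bar R) :
  measurable_fun setT F -> \int[lebesgue_cV 0]_v F v = F 0%R.
Proof. by move=> mF; rewrite /= integral_dirac// diracT mul1e. Qed.

End lebesgue_cV_integral.

Section measurable_algebra.
Context {R : realType}.

Lemma measurable_fun_mulmx d (T : measurableType d) m n p (f : T -> 'M[R]_(m, n))
    (g : T -> 'M[R]_(n, p)) :
  measurable_fun setT f -> measurable_fun setT g ->
  measurable_fun setT (fun t => f t *m g t).
Proof.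
move=> /measurable_fun_mxP mf /measurable_fun_mxP mg.
apply/measurable_fun_mxP => i j; under eq_fun do rewrite mxE.
by apply: measurable_sum => k; exact: measurable_funM.
Qed.

Lemma measurable_fun_trmx d (T : measurableType d) m n (f : T -> 'M[R]_(m, n)) :
  measurable_fun setT f -> measurable_fun setT (fun t => (f t)^T).
Proof.
move=> /measurable_fun_mxP mf.
apply/measurable_fun_mxP => i j; under eq_fun do rewrite mxE.
exact: mf.
Qed.

Lemma measurable_fun_addmx d (T : measurableType d) m n (f g : T -> 'M[R]_(m, n)) :
  measurable_fun setT f -> measurable_fun setT g ->
  measurable_fun setT (fun t => f t + g t).
Proof.
move=> /measurable_fun_mxP mf /measurable_fun_mxP mg.
apply/measurable_fun_mxP => i j; under eq_fun do rewrite mxE.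
exact: measurable_funD.
Qed.

Lemma measurable_fun_scalemx d (T : measurableType d) m n (a : R)
    (f : T -> 'M[R]_(m, n)) :
  measurable_fun setT f -> measurable_fun setT (fun t => a *: f t).
Proof.
move=> /measurable_fun_mxP mf.
apply/measurable_fun_mxP => i j; under eq_fun do rewrite mxE.
exact: measurable_funM.
Qed.

Lemma measurable_fun_quadratic d (T : measurableType d) n (B : 'M[R]_n)
    (f : T -> 'cV[R]_n) : measurable_fun setT f ->
  measurable_fun setT (fun t => ((f t)^T *m B *m f t) ord0 ord0).
Proof.
move=> mf; apply: (@measurableT_comp _ _ _ _ _ _ (fun A : 'M[R]_1 => A ord0 ord0)).
  exact: measurable_entry.
apply: measurable_fun_mulmx => //; apply: measurable_fun_mulmx => //.
exact: measurable_fun_trmx.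
Qed.

End measurable_algebra.

Section gaussian_integral.
Context {R : realType}.

Lemma measurable_quadratic_exp n (B : 'M[R]_n) (m : 'cV[R]_n) :
  measurable_fun setT (fun g : 'cV[R]_n =>
    (expR (- 2^-1 * ((g - m)^T *m B *m (g - m)) ord0 ord0))%:E).
Proof.
apply/measurable_EFinP; apply: measurableT_comp => //.
apply: measurable_funM => //; apply: measurable_fun_quadratic.
exact: measurable_fun_addmx.
Qed.

Lemma integral_quadratic_exp n (B : 'M[R]_n) (m : 'cV[R]_n) : pdmx B ->
  (\int[lebesgue_cV n]_g
     (expR (- 2^-1 * ((g - m)^T *m B *m (g - m)) ord0 ord0))%:E =
   (Num.sqrt (2 * pi) ^+ n / Num.sqrt (\det B))%:E)%E.
Proof.
elim: n B m => [|n IHn] B m pdB.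
  rewrite integral_lebesgue_cV0; last exact: measurable_quadratic_exp.
  by rewrite mxE big_ord0 mulr0 expR0 expr0 det_mx00 sqrtr1 divr1.
rewrite integral_lebesgue_cVS//; last exact: measurable_quadratic_exp.
have [b [c [D [BE b0 pdC]]]] := pdmx_schur pdB.
set C := D - _ in pdC.
pose m0 := m ord0 ord0; pose m' : 'cV[R]_n := \col_i m (lift ord0 i) ord0.
transitivity (\int[lebesgue_cV n]_v ((Num.sqrt (2 * pi) / Num.sqrt b)%:E *
    (expR (- 2^-1 * ((v - m')^T *m C *m (v - m')) ord0 ord0))%:E))%E.
  apply: eq_integral => v _.
  (* For fixed [v] the integrand is a Gaussian in [t] centred at [m0 - b^-1 c^T (v - m')]; its
     integral does not depend on that centre. *)
  rewrite -(integral_gaussian_fun (- m0 + b^-1 * (c^T *m (v - m')) ord0 ord0) b0).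
  rewrite -ge0_integralZr//; last first.
  - apply/measurable_EFinP; apply: measurableT_comp => //.
    apply: measurable_funM => //; apply: measurable_funM => //.
    by apply: measurable_funX; apply: measurable_funD.
  apply: eq_integral => t _; rewrite -EFinM -expRD -mulrDr.
  congr (expR (_ * _))%:E.
  have -> : cons_cV (t, v) - m = cons_cV (t - m0, v - m').
    apply/colP => i; have [k ->|->] := unliftP ord0 i.
      by rewrite [LHS]mxE [X in _ + X]mxE !cons_cV_lift /= !mxE.
    by rewrite [LHS]mxE [X in _ + X]mxE !cons_cV0.
  by rewrite BE schur_form ?gt_eqF// addrA.
rewrite ge0_integralZl//; last exact: measurable_quadratic_exp.
rewrite IHn// -EFinM BE (schur_det c D) ?gt_eqF// -/C (sqrtrM _ (ltW b0)).
by rewrite exprS invfM mulrACA.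
Qed.

End gaussian_integral.

(** * Change of variables and densities *)

Section affine_change_of_variables.
Context {R : realType}.
Local Open Scope ereal_scope.

(** By uniqueness of Lebesgue measure: [s] times the pushforward by [t |-> a + s t] has the right
    value on half-open intervals. *)
Lemma lebesgue_measure_affine (a s : R) (A : set (measurableTypeR R)) :
  (0 < s)%R -> measurable A ->
  s%:E * lebesgue_measure ((fun t => a + s * t)%R @^-1` A) = lebesgue_measure A.
Proof.
move=> s0 mA.
pose f : measurableTypeR R -> measurableTypeR R := (fun t => a + s * t)%R.
have mf : measurable_fun setT f by apply: measurable_funD => //; exact: measurable_funM.
pose m := mscale (NngNum (ltW s0)) (pushforward (@lebesgue_measure R) f).
rewrite [RHS](@lebesgue_measure_unique _ (m mf))// => _ [[x y] _ <-] /=.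
rewrite /m /mscale /= /pushforward.
rewrite (_ : f @^-1` _ = `]((x - a) / s)%R, ((y - a) / s)%R]%classic); last first.
  apply/seteqP; split => t /=; rewrite /f !in_itv /= ltr_pdivrMr// ler_pdivlMr//.
    by rewrite ltrBlDl lerBrDl mulrC.
  by rewrite ltrBlDl lerBrDl mulrC.
rewrite !lebesgue_measure_itv/= !lte_fin ltr_pM2r ?invr_gt0// ltrD2r.
case: ifPn => _; last by rewrite mule0.
by rewrite -!EFinB -EFinM; congr (_%:E); field; rewrite gt_eqF.
Qed.

Lemma ge0_integral_affine (a s : R) (F : R -> \bar R) : (0 < s)%R ->
  measurable_fun setT F -> (forall t, 0 <= F t) ->
  \int[lebesgue_measure]_t F (a + s * t)%R =
  s^-1%:E * \int[lebesgue_measure]_t F t.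
Proof.
move=> s0 mF F0.
pose f : measurableTypeR R -> measurableTypeR R := (fun t => a + s * t)%R.
have mf : measurable_fun setT f by apply: measurable_funD => //; exact: measurable_funM.
pose m := mscale (NngNum (ltW s0)) (pushforward (@lebesgue_measure R) f).
rewrite [in RHS](@eq_measure_integral _ _ _ _ (m mf)).
  rewrite ge0_integral_mscale// muleA -EFinM mulVf ?gt_eqF// mul1e.
  by rewrite ge0_integral_pushforward.
by move=> A mA _; exact: esym (lebesgue_measure_affine a s0 mA).
Qed.

(** Homotheties act on each coordinate separately, so the one-dimensional rule applies coordinate by
    coordinate, each giving a factor [s^-1]. *)
Lemma ge0_integral_cV_affine n (a : 'cV[R]_n) (s : R) (F : 'cV[R]_n -> \bar R) :
  (0 < s)%R -> measurable_fun setT F -> (forall v, 0 <= F v) ->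
  \int[lebesgue_cV n]_v F (a + s *: v)%R =
  (s^-1 ^+ n)%:E * \int[lebesgue_cV n]_v F v.
Proof.
have maff m (b : 'cV[R]_m) : measurable_fun setT (fun v : 'cV[R]_m => b + s *: v)%R.
  by apply: measurable_fun_addmx => //; exact: measurable_fun_scalemx.
move=> s0; elim: n a F => [|n IHn] a F mF F0.
  rewrite !integral_lebesgue_cV0//; last exact: measurableT_comp mF (maff _ _).
  by rewrite expr0 mul1e; congr F; apply/colP => -[].
rewrite !integral_lebesgue_cVS//; last exact: measurableT_comp mF (maff _ _).
pose G v := \int[lebesgue_measure]_t F (cons_cV (t, v)).
have mG : measurable_fun setT G by exact: measurable_integral_cons_cV.
have G0 v : 0 <= G v by exact: integral_ge0.
have mFv v : measurable_fun setT (fun t : measurableTypeR R => F (cons_cV (t, v))).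
  exact: measurableT_comp (measurable_comp_cons_cV mF) (measurable_pair2 _).
transitivity (\int[lebesgue_cV n]_v
    (s^-1%:E * G ((\col_i a (lift ord0 i) ord0) + s *: v)%R)).
  apply: eq_integral => v _.
  rewrite -(@ge0_integral_affine (a ord0 ord0) _
      (fun t => F (cons_cV (t, _))) s0 (mFv _))//.
  apply: eq_integral => t _; congr F; apply/colP => i.
  rewrite [LHS]mxE [X in (_ + X)%R]mxE.
  have [k ->|->] := unliftP ord0 i; last by rewrite !cons_cV0.
  by rewrite !cons_cV_lift /= !mxE.
rewrite ge0_integralZl//; last 2 first.
- exact: measurableT_comp mG (maff _ _).
- by rewrite lee_fin invr_ge0 ltW.
by rewrite IHn// muleA -EFinM exprS.
Qed.

End affine_change_of_variables.

Section density.
Context d (T : measurableType d) (R : realType).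
Local Open Scope ereal_scope.

(** The density makes [nu] absolutely continuous with respect to [mu]; its Radon-Nikodym derivative
    has the same integrals as [phi] over measurable sets, hence equals it almost everywhere. *)
Lemma ge0_integral_density (nu : {finite_measure set T -> \bar R})
    (mu : {sigma_finite_measure set T -> \bar R}) (phi F : T -> \bar R) :
  measurable_fun setT phi -> (forall t, 0 <= phi t) ->
  (forall A, measurable A -> nu A = \int[mu]_(t in A) phi t) ->
  measurable_fun setT F -> (forall t, 0 <= F t) ->
  \int[nu]_t F t = \int[mu]_t (F t * phi t).
Proof.
move=> mphi phi0 nuE mF F0.
have numu : nu `<< mu.
  apply/null_content_dominatesP => A mA muA0; rewrite nuE//.
  by apply: null_set_integral => //; exact: measurable_funTS.
have mf := measurable_int _ (Radon_Nikodym_SigmaFinite.f_integrable numu).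
rewrite -(Radon_Nikodym_SigmaFinite.change_of_variables numu)//.
apply: ge0_ae_eq_integral => //.
- exact: emeasurable_funM.
- exact: emeasurable_funM.
- by move=> t _; rewrite mule_ge0// Radon_Nikodym_SigmaFinite.f_ge0.
- by move=> t _; rewrite mule_ge0.
apply: ae_eqe_mul2l; apply: integral_ae_eq => //.
  exact: Radon_Nikodym_SigmaFinite.f_integrable.
by move=> A _ mA; rewrite -Radon_Nikodym_SigmaFinite.f_integral// nuE.
Qed.

End density.

(** The integral of a nonnegative function is a supremum over the simple functions below it, so
    monotonicity is available for functions known only to be continuous, as in
    [continuous_density_ge]. *)
Lemma ge0_le_integral_pointwise d (T : measurableType d) (R : realType)
    (mu : {measure set T -> \bar R}) (D : set T) (f g : T -> \bar R) :
  (forall t, D t -> 0 <= f t)%E -> (forall t, D t -> f t <= g t)%E ->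
  (\int[mu]_(t in D) f t <= \int[mu]_(t in D) g t)%E.
Proof.
move=> f0 fg; rewrite !(integral_mkcond D).
have fgD t : (f \_ D t <= g \_ D t)%E by exact: lee_restrict.
have fD0 t : (0 <= f \_ D t)%E by exact: erestrict_ge0.
rewrite !ge0_integralTE//; last by move=> t; exact: le_trans (fgD t).
apply: le_ereal_sup => _ [h hf <-]; exists h => // t.
exact: le_trans (fgD t).
Qed.

Section continuous_density.
Context {R : realType} (n : nat).
Implicit Types (q f : 'cV[R]_n -> R) (x : 'cV[R]_n).

(** If [q x < f x], continuity keeps [q] and [f] apart on a small box around [x]; its volume is
    positive and finite, so the two integrals over it differ. *)
Lemma continuous_density_ge q f x :
  {for x, continuous q} -> {for x, continuous f} ->
  (forall y, 0 <= q y) -> (forall y, 0 <= f y) ->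
  (forall A, measurable A ->
    (\int[lebesgue_cV n]_(y in A) (q y)%:E =
     \int[lebesgue_cV n]_(y in A) (f y)%:E)%E) ->
  f x <= q x.
Proof.
move=> cq cf q0 f0 qf; rewrite leNgt; apply/negP => qxfx.
(* A third of the gap, so that [q x + e < f x - e]. *)
pose e := (f x - q x) / 3.
have e0 : 0 < e by rewrite divr_gt0// subr_gt0.
have : \forall y \near x, `|q x - q y| < e /\ `|f x - f y| < e.
  by near=> y; split; near: y; [exact: (cvgrPdist_lt _ _).1 cq _ e0|
                                exact: (cvgrPdist_lt _ _).1 cf _ e0].
move=> /nbhs_ballP[r /= r0 xr].
(* Balls of column vectors are those of the sup norm, so this box lies in the ball of radius [r],
   and [lebesgue_cV_box] gives its volume. *)
pose I (i : 'I_n) : set R := `](x i ord0 - r), (x i ord0 + r)[%classic.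
pose B := [set v : 'cV[R]_n | forall i, I i (v i ord0)].
have mB : measurable B.
  rewrite (_ : B = \bigcap_(i : 'I_n) ((fun v : 'cV[R]_n => v i ord0) @^-1` I i)).
    apply: fin_bigcap_measurable => // i _.
    rewrite -[X in measurable X]setTI; apply: measurable_entry => //.
    exact: measurable_itv.
  by apply/seteqP; split => [v Bv i _|v Bv i]; exact: Bv.
have Br v : B v -> `|q x - q v| < e /\ `|f x - f v| < e.
  move=> Bv; apply: xr; split=> // i j; rewrite [j]ord1 -ball_normE /= ltr_norml.
  by have := Bv i; rewrite /I /= in_itv /= => /andP[? ?]; apply/andP; split; lra.
have BE : lebesgue_cV n B = ((r + r) ^+ n)%:E.
  rewrite lebesgue_cV_box => [|i]; last exact: measurable_itv.
  rewrite -[X in (_ ^+ X)%:E]card_ord -prodr_const -prodEFin.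
  apply: eq_bigr => i _; rewrite lebesgue_measure_itv/= lte_fin.
  by rewrite ifT -?EFinB; [congr (_%:E); ring|lra].
have := qf _ mB; apply/eqP; rewrite lt_eqF//.
apply: (@le_lt_trans _ _ (\int[lebesgue_cV n]_(y in B) (q x + e)%:E)%E).
  apply: ge0_le_integral_pointwise => y By; rewrite lee_fin//.
  by have [] := Br y By; rewrite ltr_norml => /andP[? ?] _; lra.
apply: (@lt_le_trans _ _ (\int[lebesgue_cV n]_(y in B) (f x - e)%:E)%E); last first.
  apply: ge0_le_integral_pointwise => y By; rewrite lee_fin.
    (* [f x - e] is [(2 f x + q x) / 3], nonnegative since [0 <= q x < f x]. *)
    by have := q0 x; rewrite /e; lra.
  by have [] := Br y By; rewrite !ltr_norml => _ /andP[? ?]; lra.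
rewrite !integral_cst//.
rewrite [X in (_ * X < _)%E]BE [X in (_ < _ * X)%E]BE -!EFinM lte_fin.
rewrite ltr_pM2r ?exprn_gt0//; last lra.
by rewrite /e; lra.
Unshelve. all: by end_near. Qed.

Lemma continuous_density_unique q f :
  continuous q -> continuous f -> (forall y, 0 <= q y) -> (forall y, 0 <= f y) ->
  (forall A, measurable A ->
    (\int[lebesgue_cV n]_(y in A) (q y)%:E =
     \int[lebesgue_cV n]_(y in A) (f y)%:E)%E) ->
  q = f.
Proof.
move=> cq cf q0 f0 qf; apply/funext => x; apply/eqP.
rewrite eq_le; apply/andP; split; apply: continuous_density_ge => //;
  try exact: cq; try exact: cf.
by move=> A mA; rewrite (qf A).
Qed.

End continuous_density.

(** * Convolution of Gaussian densities *)

Section gaussian_density.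
Context {R : realType} (n : nat).

Definition std_gaussian_pdf (g : 'cV[R]_n) : R :=
  \prod_(i < n) normal_pdf 0 1 (g i ord0).

Lemma std_gaussian_pdf_ge0 g : 0 <= std_gaussian_pdf g.
Proof. by apply: prodr_ge0 => i _; exact: normal_pdf_ge0. Qed.

Lemma measurable_std_gaussian_pdf : measurable_fun setT std_gaussian_pdf.
Proof.
apply: measurable_prod => i _.
exact: measurableT_comp (measurable_normal_pdf _ _) (measurable_entry _ _).
Qed.

Lemma std_gaussian_pdfE g : std_gaussian_pdf g =
  (Num.sqrt (2 * pi))^-1 ^+ n * expR (- 2^-1 * (g^T *m g) ord0 ord0).
Proof.
rewrite /std_gaussian_pdf.
under eq_bigr do rewrite normal_pdfE ?oner_neq0//.
rewrite big_split /= prodr_const card_ord; congr (_ * _).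
  by rewrite /normal_peak expr1n mul1r mulr_natl.
rewrite -expR_sum mxE mulr_sumr; congr expR; apply: eq_bigr => i _.
by rewrite mxE subr0 expr1n; field.
Qed.

(* The centered Gaussian density with covariance [(M^T M)^-1], for [\det M > 0]. *)
Definition gaussian_pdf (M : 'M[R]_n) (y : 'cV[R]_n) : R :=
  (Num.sqrt (2 * pi))^-1 ^+ n * \det M *
  expR (- 2^-1 * ((M *m y)^T *m (M *m y)) ord0 ord0).

Lemma pdmx_unit (A : 'M[R]_n) : pdmx A -> A \in unitmx.
Proof. by move=> /pdmx_det_gt0 A0; rewrite unitmxE unitfE gt_eqF. Qed.

Lemma pdmx_scale (a : R) (A : 'M[R]_n) : 0 < a -> pdmx A -> pdmx (a *: A).
Proof.
move=> a0 [As Ap]; split=> [|v v0]; first by rewrite linearZ /= As.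
by rewrite -scalemxAr -scalemxAl mxE mulr_gt0// Ap.
Qed.

Lemma mulmx_norm_gt0 m (A : 'M[R]_(m, n)) (v : 'cV[R]_n) :
  A *m v != 0 -> 0 < ((A *m v)^T *m (A *m v)) ord0 ord0.
Proof.
move=> Av0; rewrite mxE lt_def; apply/andP; split; last first.
  by apply: sumr_ge0 => i _; rewrite mxE -expr2 sqr_ge0.
apply: contra Av0; rewrite psumr_eq0 => [/allP/= Av|i _]; last first.
  by rewrite mxE -expr2 sqr_ge0.
apply/eqP/colP => i; rewrite [RHS]mxE.
by have := Av i (mem_index_enum _); rewrite mxE -expr2 sqrf_eq0 => /eqP.
Qed.

Lemma pdmx_sqr (T : 'M[R]_n) : T^T = T -> T \in unitmx -> pdmx (T *m T).
Proof.
move=> Ts Tu; split=> [|v v0]; first by rewrite trmx_mul Ts.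
rewrite mulmxA -(mulmxA _ T v) -[in X in X *m _]Ts -trmx_mul mulmx_norm_gt0//.
by apply: contra v0 => /eqP Tv0; rewrite -(mulKmx Tu v) Tv0 mulmx0.
Qed.

(* Completing the square: the exponent of the joint density of [(g, S g + s w)]
   at [(g, y)] is quadratic in [g] with Hessian [s^-2 T^2], minimal at
   [g = T^-2 S y]. *)
Lemma complete_square (S T : 'M[R]_n) (s : R) (g y : 'cV[R]_n) :
  s != 0 -> S^T = S -> T^T = T -> T \in unitmx ->
  T *m T = S *m S + (s ^+ 2)%:M ->
  let M := invmx T in let m := M *m M *m S *m y in
  ((s^-1 *: (y - S *m g))^T *m (s^-1 *: (y - S *m g))) ord0 ord0 +
  (g^T *m g) ord0 ord0 =
  ((g - m)^T *m (s ^- 2 *: (T *m T)) *m (g - m)) ord0 ord0 +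
  ((M *m y)^T *m (M *m y)) ord0 ord0.
Proof.
move=> s0 Ss Ts Tu TT M m.
have [W WE] : exists W, W = M *m M by exists (M *m M).
have mE : m = W *m S *m y by rewrite WE.
have WT : W *m (T *m T) = 1%:M.
  by rewrite WE mulmxA -(mulmxA M M T) mulVmx// mulmx1 mulVmx.
have TW : T *m T *m W = 1%:M by exact: mulmx1C.
(* [S] commutes with [T *m T], which is [S *m S] plus a scalar matrix, hence with its inverse
   [W]. *)
have SW : S *m W = W *m S.
  have ST : S *m (T *m T) = T *m T *m S.
    by rewrite TT mulmxDl mulmxDr mulmxA scalar_mxC.
  rewrite -[LHS]mul1mx -WT (mulmxA _ S W) -(mulmxA W _ S) -ST (mulmxA W S).
  by rewrite -(mulmxA (W *m S)) TW mulmx1.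
(* This yields [y^T S m = y^T y - s^2 y^T W y], from which the minimal value comes out as
   [y^T W y]. *)
have SWS : S *m W *m S = 1%:M - s ^+ 2 *: W.
  rewrite SW -mulmxA (_ : S *m S = T *m T - (s ^+ 2)%:M); last by rewrite TT addrK.
  by rewrite mulmxBr WT mul_mx_scalar.
have TTm : T *m T *m m = S *m y by rewrite mE -(mulmxA W) (mulmxA _ W) TW mul1mx.
have mTT : m^T *m (T *m T) = y^T *m S.
  have TTs : (T *m T)^T = T *m T by rewrite trmx_mul Ts.
  by rewrite -[in LHS]TTs -trmx_mul TTm trmx_mul Ss.
have -> : (s^-1 *: (y - S *m g))^T *m (s^-1 *: (y - S *m g)) =
    s ^- 2 *: (y^T *m y - y^T *m S *m g - g^T *m S *m y + g^T *m (S *m S) *m g).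
  rewrite -scalemxAr [(s^-1 *: _)^T]linearZ /= -scalemxAl scalerA -expr2 exprVn.
  congr (_ *: _); rewrite [(_ - _)^T]linearB /= trmx_mul Ss mulmxBr !mulmxBl !mulmxA opprB addrA.
  by rewrite addrAC; congr (_ + _); rewrite addrAC.
have -> : (g - m)^T *m (s ^- 2 *: (T *m T)) *m (g - m) =
    s ^- 2 *: (g^T *m (S *m S) *m g + s ^+ 2 *: (g^T *m g) - g^T *m S *m y
      - y^T *m S *m g + (y^T *m y - s ^+ 2 *: (y^T *m W *m y))).
  rewrite -scalemxAr -scalemxAl; congr (_ *: _).
  have -> : y^T *m y - s ^+ 2 *: (y^T *m W *m y) = y^T *m S *m m.
    rewrite mE !mulmxA -!(mulmxA y^T) SWS mulmxBl mul1mx mulmxBr.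
    by rewrite -scalemxAl -scalemxAr.
  have -> : g^T *m (S *m S) *m g + s ^+ 2 *: (g^T *m g) = g^T *m (T *m T) *m g.
    by rewrite TT mulmxDr mulmxDl mul_mx_scalar -scalemxAl.
  rewrite [(_ - _)^T]linearB /= mulmxBl mTT mulmxBr !mulmxBl -(mulmxA g^T _ m) TTm mulmxA.
  by rewrite opprB addrA addrAC -!addrA; congr (_ + _); rewrite addrC addrAC -!addrA.
have -> : (M *m y)^T *m (M *m y) = y^T *m W *m y.
  by rewrite trmx_mul trmx_inv Ts -/M WE !mulmxA.
rewrite !(mxE, scalerBr) /=.
by field.
Qed.

(** The integrand is the joint density at [(g, y)] of [g] and [S g + s h], for independent standard
    Gaussians [g] and [h]; by [complete_square] its integral in [g] is a Gaussian one. *)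
Lemma integral_gaussian_convolution (S T : 'M[R]_n) (s : R) (y : 'cV[R]_n) :
  0 < s -> S^T = S -> pdmx T -> T *m T = S *m S + (s ^+ 2)%:M ->
  (\int[lebesgue_cV n]_g
    (s^-1 ^+ n * std_gaussian_pdf (s^-1 *: (y - S *m g)) * std_gaussian_pdf g)%:E =
   (gaussian_pdf (invmx T) y)%:E)%E.
Proof.
move=> s0 Ss pdT TT; have Tu := pdmx_unit pdT; have Ts := pdT.1.
set M := invmx T; pose m := M *m M *m S *m y.
pose c := s^-1 ^+ n * ((Num.sqrt (2 * pi))^-1 ^+ n) ^+ 2 *
  expR (- 2^-1 * ((M *m y)^T *m (M *m y)) ord0 ord0).
pose B := s ^- 2 *: (T *m T).
have pdB : pdmx B.
  by apply: pdmx_scale; [rewrite invr_gt0 exprn_gt0|exact: pdmx_sqr].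
transitivity (\int[lebesgue_cV n]_g (c%:E *
    (expR (- 2^-1 * ((g - m)^T *m B *m (g - m)) ord0 ord0))%:E))%E.
  apply: eq_integral => g _; rewrite !std_gaussian_pdfE -EFinM; congr (_%:E).
  have := complete_square g y (lt0r_neq0 s0) Ss Ts Tu TT; rewrite -/M -/m -/B /= => cs.
  have {}cs := congr1 (fun r => expR (- 2^-1 * r)) cs.
  rewrite !mulrDr !expRD in cs; rewrite /c.
  by rewrite -mulrA (mulrACA (_ ^+ n) (expR _)) cs; ring.
rewrite ge0_integralZl//; last 2 first.
- exact: measurable_quadratic_exp.
- by rewrite lee_fin !mulr_ge0 ?expR_ge0 ?exprn_ge0 ?invr_ge0 ?sqrtr_ge0// ltW.
rewrite integral_quadratic_exp// -EFinM; congr (_%:E).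
have T0 := pdmx_det_gt0 pdT.
(* The factor [s^-1 ^+ n] cancels the one in [c]; dividing by [\det T] gives the determinant of
   [invmx T]. *)
have -> : Num.sqrt (\det B) = s^-1 ^+ n * \det T.
  rewrite /B detZ det_mulmx -expr2 -exprVn -exprM mulnC exprM -exprMn sqrtr_sqr.
  by rewrite ger0_norm// mulr_ge0 ?exprn_ge0 ?invr_ge0 ?ltW.
rewrite /gaussian_pdf det_inv /c; set p := Num.sqrt (2 * pi).
have p0 : 0 < p by rewrite sqrtr_gt0 mulr_gt0// pi_gt0.
rewrite !exprVn -/M; field.
by rewrite !expf_neq0 ?gt_eqF.
Qed.

End gaussian_density.

(** * Laws of independent sums and mixtures *)

Section product_law.
Context d1 d2 (T1 : measurableType d1) (T2 : measurableType d2) (R : realType).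
Local Open Scope ereal_scope.

(** Both iterated constructions agree on rectangles, which determines the product; the variable
    integrated last can thus be chosen. *)
Lemma product_measure12 (m1 : {sigma_finite_measure set T1 -> \bar R})
    (m2 : {sigma_finite_measure set T2 -> \bar R}) (E : set (T1 * T2)) :
  measurable E -> (m1 \x m2) E = (m1 \x^ m2) E.
Proof.
by move=> mE; apply: product_measure_unique => // A B mA mB; exact: product_measure2E.
Qed.

Lemma indep2_law d (Omega : measurableType d) (P : probability Omega R)
    (X : {RV P >-> T1}) (Y : {RV P >-> T2}) (E : set (T1 * T2)) :
  indep2 P (sigma_of Y) (sigma_of X) -> measurable E ->
  P [set t | E (X t, Y t)] = (distribution P X \x distribution P Y) E.
Proof.
move=> ind mE.
have mXY : measurable_fun setT (fun t => (X t, Y t)).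
  by apply/measurable_fun_pairP; split; exact: measurable_funP.
pose XY : {mfun Omega >-> (T1 * T2)%type} :=
  HB.pack (fun t => (X t, Y t)) (isMeasurableFun.Build _ _ _ _ _ mXY).
rewrite (@product_measure_unique _ _ _ _ _ _ _ (distribution P XY))// => A B mA mB.
rewrite muleC -ind; last 2 first.
- by exists B => //; rewrite setTI.
- by exists A => //; rewrite setTI.
by congr (P _); apply/seteqP; split => t [].
Qed.

End product_law.

Section gaussian_sum.
Context {R : realType} (n : nat).

(** [(S + 1)(S - 1) = 0] and [S + 1] is positive definite, hence invertible. This identifies the
    root that [is_gaussian P 1%:M] provides. *)
Lemma psdmx_sqr1 (S : 'M[R]_n) : psdmx S -> S *m S = 1%:M -> S = 1%:M.
Proof.
move=> [Ss Sp] SS1; have pd : pdmx (S + 1%:M).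
  split=> [|v v0]; first by rewrite linearD /= Ss trmx1.
  rewrite mulmxDr mulmxDl mxE mulmx1 ltr_wpDl ?Sp//.
  by rewrite -[v]mul1mx mulmx_norm_gt0// mul1mx.
apply/eqP; rewrite -subr_eq0 -(mulKmx (pdmx_unit pd) (S - 1%:M)).
by rewrite mulmxBr mulmx1 mulmxDl SS1 mul1mx [1%:M + S]addrC subrr mulmx0.
Qed.

Context d (Omega : measurableType d) (P : probability Omega R).
Local Open Scope ereal_scope.

Lemma is_gaussian1_law (w : {RV P >-> 'cV[R]_n}) (A : set 'cV[R]_n) :
  is_gaussian P 1%:M w -> measurable A ->
  distribution P w A = \int[lebesgue_cV n]_(g in A) (std_gaussian_pdf g)%:E.
Proof.
move=> [S [Spsd /(psdmx_sqr1 Spsd) -> wE]] mA; rewrite /distribution /pushforward wE//.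
by congr std_gaussian; apply/seteqP; split => v /=; rewrite mul1mx.
Qed.

Lemma measurable_affine_pair (s : R) (A : set 'cV[R]_n) : measurable A ->
  measurable [set p : 'cV[R]_n * 'cV[R]_n | A (p.1 + s *: p.2)%R].
Proof.
move=> mA; have mf : measurable_fun setT
    (fun p : 'cV[R]_n * 'cV[R]_n => (p.1 + s *: p.2)%R).
  apply: measurable_fun_addmx; first exact: measurable_fst.
  by apply: measurable_fun_scalemx; exact: measurable_snd.
by rewrite -[X in measurable X]setTI; exact: mf.
Qed.

(** Stated for the product of the laws, since [w] is assumed independent of [z] rather than of each
    [u k]. The law of [u] may have no density, so it is disintegrated through [S g], and only [w] is
    changed of variables. *)
Lemma gaussian_convolution (u w : {RV P >-> 'cV[R]_n}) (S T : 'M[R]_n) (s : R)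
    (A : set 'cV[R]_n) :
  (0 < s)%R -> S^T = S -> pdmx T -> T *m T = (S *m S + (s ^+ 2)%:M)%R ->
  (forall B, measurable B -> P (u @^-1` B) = std_gaussian (mulmx S @^-1` B)) ->
  is_gaussian P 1%:M w -> measurable A ->
  (distribution P u \x distribution P w)
    [set p : 'cV[R]_n * 'cV[R]_n | A (p.1 + s *: p.2)%R] =
  \int[lebesgue_cV n]_(y in A) (gaussian_pdf (invmx T) y)%:E.
Proof.
move=> s0 Ss pdT TT uE wg mA.
(* [J (a, y)] is the density of [a + s w] at [y], cut off to [A]. *)
pose J (p : 'cV[R]_n * 'cV[R]_n) : \bar R :=
  (\1_A p.2 * (s^-1 ^+ n * std_gaussian_pdf (s^-1 *: (p.2 - p.1))))%:E.
have J0 p : 0 <= J p.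
  rewrite lee_fin !mulr_ge0 ?std_gaussian_pdf_ge0//.
  by rewrite exprn_ge0// invr_ge0 ltW.
have mphi := @measurable_std_gaussian_pdf R n.
have mJ : measurable_fun setT J.
  apply/measurable_EFinP; apply: measurable_funM.
    apply: (@measurableT_comp _ _ _ _ _ _ (\1_A : _ -> R)) => //; exact: measurable_snd.
  apply: measurable_funM => //; apply: (measurableT_comp mphi).
  apply: measurable_fun_scalemx; apply: measurable_fun_addmx.
    exact: measurable_snd.
  rewrite (_ : (fun t => _) = (fun t : 'cV[R]_n * 'cV[R]_n => -1 *: t.1)%R).
    by apply: measurable_fun_scalemx; exact: measurable_fst.
  by apply/funext => t; rewrite scaleN1r.
pose H a := \int[lebesgue_cV n]_y J (a, y).
have H0 a : 0 <= H a by exact: integral_ge0.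
have mH : measurable_fun setT H by exact: measurable_fun_fubini_tonelli_F.
have mS : measurable_fun setT (mulmx S : 'cV[R]_n -> 'cV[R]_n).
  exact: measurable_fun_mulmx.
have wsec a : distribution P w
    (xsection [set p : 'cV[R]_n * 'cV[R]_n | A (p.1 + s *: p.2)%R] a) = H a.
  have maff : measurable_fun setT (fun h : 'cV[R]_n => a + s *: h)%R.
    by apply: measurable_fun_addmx => //; exact: measurable_fun_scalemx.
  rewrite is_gaussian1_law//; last first.
    by apply: measurable_xsection; exact: measurable_affine_pair.
  pose F y := (\1_A y * std_gaussian_pdf (s^-1 *: (y - a)))%:E.
  transitivity (\int[lebesgue_cV n]_h F (a + s *: h)%R).
    rewrite integral_mkcond; apply: eq_integral => h _.
    rewrite /F (_ : a + s *: h - a = s *: h)%R; last by rewrite addrC addKr.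
    rewrite scalerA mulVf ?gt_eqF// scale1r patchE mem_xsection.
    rewrite indicE (_ : ((a, h) \in _) = (a + s *: h \in A)%R); last first.
      by apply/idP/idP; rewrite !inE.
    by case: ifPn; rewrite ?mul1r ?mul0r.
  have mF : measurable_fun setT F.
    apply/measurable_EFinP; apply: measurable_funM => //.
    apply: (measurableT_comp mphi); apply: measurable_fun_scalemx.
    exact: measurable_fun_addmx.
  have F0 y : 0 <= F y by rewrite lee_fin mulr_ge0// std_gaussian_pdf_ge0.
  rewrite ge0_integral_cV_affine// -ge0_integralZl//; last first.
    by rewrite lee_fin exprn_ge0// invr_ge0 ltW.
  by apply: eq_integral => y _; rewrite -EFinM mulrCA.
rewrite /product_measure1 /=; under eq_integral do rewrite wsec.
pose SM : {mfun 'cV[R]_n >-> 'cV[R]_n} :=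
  HB.pack (mulmx S) (isMeasurableFun.Build _ _ _ _ _ mS).
(* As [w] is standard Gaussian, its law can serve as that of [g]: the law of [u] is its pushforward
   by [S]. *)
transitivity (\int[distribution (distribution P w) SM]_a H a).
  apply: eq_measure_integral => B mB _ /=.
  have mSB : measurable (mulmx S @^-1` B).
    by rewrite -[X in measurable X]setTI; exact: (mS measurableT B mB).
  transitivity (distribution P w (mulmx S @^-1` B)); last by [].
  by rewrite (is_gaussian1_law wg mSB); exact: (uE B mB).
rewrite ge0_integral_distribution//.
rewrite (@ge0_integral_density _ _ _ _ (lebesgue_cV n)
  (fun g => (std_gaussian_pdf g)%:E)); last 5 first.
- exact/measurable_EFinP.
- by move=> g; rewrite lee_fin std_gaussian_pdf_ge0.
- by move=> B mB; exact: is_gaussian1_law.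
- exact: measurableT_comp mH mS.
- by move=> g; exact: H0.
pose K (p : 'cV[R]_n * 'cV[R]_n) := J (S *m p.1, p.2) * (std_gaussian_pdf p.1)%:E.
have K0 p : 0 <= K p by rewrite mule_ge0// lee_fin std_gaussian_pdf_ge0.
have mK : measurable_fun setT K.
  apply: emeasurable_funM.
    apply: (measurableT_comp mJ); apply/measurable_fun_pairP; split => /=.
      exact: measurableT_comp mS measurable_fst.
    exact: measurable_snd.
  by apply/measurable_EFinP; exact: measurableT_comp mphi measurable_fst.
transitivity (\int[lebesgue_cV n]_g \int[lebesgue_cV n]_y K (g, y)).
  apply: eq_integral => g _; rewrite /K /= ge0_integralZr//.
  - exact: measurableT_comp mJ (measurable_pair1 _).
  - by rewrite lee_fin std_gaussian_pdf_ge0.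
(* Exchanging the integrals puts [g] inside, at fixed [y], where [integral_gaussian_convolution]
   applies. *)
rewrite (fubini_tonelli K mK K0) [RHS]integral_mkcond; apply: eq_integral => y _.
rewrite patchE; case: ifPn => yA; last first.
  rewrite integral0_eq// => g _; rewrite /K /J /= indicE (negbTE yA).
  by rewrite mul0r mul0e.
rewrite -(integral_gaussian_convolution _ s0 Ss pdT TT).
by apply: eq_integral => g _; rewrite /K /J /= indicE yA mul1r -EFinM.
Qed.

End gaussian_sum.

(** * Gradient of a log-sum of Gaussians *)

Section gradient.
Context {R : realType}.

Lemma trmx_mul_norm2E n (v : 'cV[R]_n) : (v^T *m v) ord0 ord0 = norm2 v ^+ 2.
Proof.
rewrite /norm2 sqr_sqrtr; last by apply: sumr_ge0 => i _; exact: sqr_ge0.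
by rewrite mxE; apply: eq_bigr => i _; rewrite mxE expr2.
Qed.

Lemma derive_entry n (x v : 'cV[R]_n) (i : 'I_n) :
  'D_v (fun y : 'cV[R]_n => y i ord0) x = v i ord0.
Proof.
rewrite deriveE; last exact: differentiable_coord.
(* Packed as a continuous linear map, the coordinate is its own differential. *)
have @f : {linear 'cV[R]_n -> R}.
  by exists (fun N : 'cV[R]_n => N i ord0); do 2![eexists]; do ?[constructor];
     rewrite ?mxE// => ? *; rewrite ?mxE//; move=> ?; rewrite !mxE.
rewrite (_ : (fun _ => _) = f) // diff_lin//; exact: coord_continuous.
Qed.

Lemma mulmx_entryE n (M : 'M[R]_n) (i : 'I_n) :
  (fun y : 'cV[R]_n => (M *m y) i ord0) =
  \sum_(j < n) (M i j *: (fun y : 'cV[R]_n => y j ord0)).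
Proof. by apply/funext => y; rewrite mxE fct_sumE. Qed.

Lemma differentiable_mulmx_entry n (M : 'M[R]_n) (i : 'I_n) (x : 'cV[R]_n) :
  differentiable (fun y : 'cV[R]_n => (M *m y) i ord0) x.
Proof.
rewrite mulmx_entryE; apply: differentiable_sum => j.
by apply: differentiableZ; exact: differentiable_coord.
Qed.

Lemma derive_mulmx_entry n (M : 'M[R]_n) (i : 'I_n) (x v : 'cV[R]_n) :
  'D_v (fun y : 'cV[R]_n => (M *m y) i ord0) x = (M *m v) i ord0.
Proof.
rewrite mulmx_entryE derive_sum => [|j]; last first.
  by apply: derivableZ; apply: diff_derivable; exact: differentiable_coord.
rewrite mxE; apply: eq_bigr => j _.
rewrite deriveZ; last by apply: diff_derivable; exact: differentiable_coord.
by rewrite derive_entry.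
Qed.

Lemma mulmx_normE n (M : 'M[R]_n) :
  (fun y : 'cV[R]_n => ((M *m y)^T *m (M *m y)) ord0 ord0) =
  \sum_(i < n) ((fun y : 'cV[R]_n => (M *m y) i ord0) ^+ 2).
Proof.
by apply/funext => y; rewrite mxE fct_sumE; apply: eq_bigr => i _; rewrite mxE.
Qed.

Lemma differentiable_mulmx_norm n (M : 'M[R]_n) (x : 'cV[R]_n) :
  differentiable (fun y : 'cV[R]_n => ((M *m y)^T *m (M *m y)) ord0 ord0) x.
Proof.
rewrite mulmx_normE; apply: differentiable_sum => i.
by apply: differentiableX; exact: differentiable_mulmx_entry.
Qed.

Lemma derive_mulmx_norm n (M : 'M[R]_n) (x v : 'cV[R]_n) :
  'D_v (fun y : 'cV[R]_n => ((M *m y)^T *m (M *m y)) ord0 ord0) x =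
  2 * ((M *m x)^T *m (M *m v)) ord0 ord0.
Proof.
have dM i := @diff_derivable _ _ _ _ _ v (differentiable_mulmx_entry M i x).
rewrite mulmx_normE derive_sum => [|i]; last exact: derivableX.
rewrite mxE mulr_sumr; apply: eq_bigr => i _.
rewrite deriveX// derive_mulmx_entry expr1 [_^T _ _]mxE.
exact: esym (mulrA _ _ _).
Qed.

Lemma differentiable_comp1 (V : normedModType R) (f : V -> R) (g : R -> R)
    (g' : R) (x : V) :
  differentiable f x -> is_derive (f x) 1 g g' -> differentiable (g \o f) x.
Proof.
move=> df dg; apply: differentiable_comp => //.
exact/derivable1_diffP/ex_derive.
Qed.

Lemma derive_comp1 (V : normedModType R) (f : V -> R) (g : R -> R) (g' : R)
    (x v : V) :
  differentiable f x -> is_derive (f x) 1 g g' ->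
  'D_v (g \o f) x = g' * 'D_v f x.
Proof.
move=> df dg; have dg1 : derivable g (f x) 1 by exact: ex_derive.
rewrite deriveE; last exact: differentiable_comp1 dg.
rewrite diff_comp//; last exact/derivable1_diffP.
by rewrite /= deriv1E// derive1E derive_val -deriveE// mulrC.
Qed.

(** The constant [a] drops out of the logarithmic derivative; each [E k] contributes itself times
    [- (M k)^T (M k) x], the 2 from the square cancelling the factor one half. *)
Lemma gradient_log_sum n K (M : 'I_K -> 'M[R]_n) (a : R) (q : 'cV[R]_n -> R)
    (x : 'cV[R]_n) :
  let E k (y : 'cV[R]_n) :=
    expR (- 2^-1 * ((M k *m y)^T *m (M k *m y)) ord0 ord0) in
  (0 < K)%N -> 0 < a -> q = (fun y => a * \sum_(k < K) E k y) ->
  [/\ 0 < q x, continuous q, differentiable (fun y => ln (q y)) x &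
      gradient (fun y => ln (q y)) x =
      - \sum_(k < K) (E k x / \sum_(i < K) E i x) *: ((M k)^T *m (M k *m x))].
Proof.
move=> E K0 a0 qM.
pose N k (y : 'cV[R]_n) := ((M k *m y)^T *m (M k *m y)) ord0 ord0.
have dN k y : differentiable (- 2^-1 *: N k) y.
  by apply: differentiableZ; exact: differentiable_mulmx_norm.
have EE k : E k = expR \o (- 2^-1 *: N k) by apply/funext.
have dE k y : differentiable (E k) y.
  by rewrite EE; apply: differentiable_comp1 (dN k y) _.
have qE : q = a *: \sum_(k < K) E k by rewrite qM; apply/funext => y; rewrite /= fct_sumE.
have dq y : differentiable q y.
  by rewrite qE; apply: differentiableZ; apply: differentiable_sum => k.
have S0 y : 0 < \sum_(k < K) E k y.
  rewrite (bigD1 (Ordinal K0))//= ltr_pwDl ?expR_gt0//.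
  by apply: sumr_ge0 => k _; exact: expR_ge0.
have q0 y : 0 < q y by rewrite qM mulr_gt0.
have dln := is_derive1_ln (q0 x).
split => //.
- by move=> y; apply: differentiable_continuous.
- exact: differentiable_comp1 (dq x) dln.
have DE k v : derivable (E k) x v by exact: diff_derivable.
have Dq v : 'D_v q x = a * \sum_(k < K) 'D_v (E k) x.
  by rewrite qE deriveZ; [rewrite derive_sum|exact: derivable_sum].
apply/colP => i; rewrite mxE (derive_comp1 _ (dq x) dln) Dq mxE summxE -sumrN.
rewrite qM invfM mulrACA mulVf ?gt_eqF// mul1r mulr_sumr; apply: eq_bigr => k _.
rewrite EE (derive_comp1 _ (dN k x) (is_derive_expR _)).
rewrite deriveZ; last by apply: diff_derivable; exact: differentiable_mulmx_norm.
rewrite derive_mulmx_norm -EE.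
have -> : ((M k *m x)^T *m (M k *m (delta_mx i ord0 : 'cV[R]_n))) ord0 ord0 =
    ((M k)^T *m (M k *m x)) i ord0.
  rewrite mulmxA -colE mxE -[in RHS](trmxK (M k *m x)) -trmx_mul.
  by rewrite [RHS]mxE.
rewrite [X in _ = - X]mxE /= -[expR _]/(E k x) [- 2^-1 *: _]mulrA.
by rewrite mulNr mulVf// mulN1r !mulrN mulrA [_^-1 * _]mulrC.
Qed.

(** The Kronecker product with the identity is block diagonal with k-th block [p k] times the
    identity, so the product is a weighted sum over blocks. *)
Lemma hconcat_diag_vconcat d K (M : 'I_K -> 'M[R]_d) (p : 'cV[R]_K)
    (v : 'I_K -> 'cV[R]_d) :
  hconcat M *m (diag_mx p^T *t (1%:M : 'M[R]_d)) *m vconcat v =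
  \sum_(k < K) p k ord0 *: (M k *m v k).
Proof.
apply/colP => i.
(* Flat indices are split into pairs (block, position in the block). *)
have rei (F : 'I_(K * d) -> R) : \sum_j F j = \sum_k \sum_j F (mxtens_index (k, j)).
  rewrite pair_big /= (reindex (@mxtens_index K d)) /=.
    by apply: eq_bigr => -[].
  by exists (@mxtens_unindex K d) => j _; rewrite ?mxtens_indexK ?mxtens_unindexK.
rewrite mxE rei summxE; apply: eq_bigr => k _.
rewrite [RHS]mxE [X in _ = _ * X]mxE mulr_sumr; apply: eq_bigr => j _.
rewrite [vconcat _ _ _]mxE mxtens_indexK /= mulrA; congr (_ * _).
rewrite mxE rei (bigD1 k) //= (bigD1 j) //= !(mxE, mxtens_indexK) /= !eqxx.
(* The vanishing terms are the other positions in block [k] and all the other blocks. *)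
rewrite !mulr1n mulr1 mulrC [X in _ + X + _]big1 ?[X in _ + X]big1 ?addr0//.
- move=> l lk; apply: big1 => m _.
  by rewrite !(mxE, mxtens_indexK) /= (negbTE lk) mulr0n mul0r mulr0.
- by move=> l lj; rewrite !(mxE, mxtens_indexK) /= (negbTE lj) !mulr0.
Qed.

End gradient.

(** * Law of a mixture with an independent random index *)

Section mixture.
Context d d' (Omega : measurableType d) (T : measurableType d') (R : realType).
Context (P : probability Omega R) (K : nat).
Context (u : 'I_K -> {RV P >-> T}) (idx : Omega -> 'I_K) (p : 'I_K -> R).
Hypothesis idx_measurable : forall k, measurable (idx @^-1` [set k]).
Hypothesis idx_law : forall k, P (idx @^-1` [set k]) = (p k)%:E.
Hypothesis idx_indep : indep2 P (sigma_of_index idx) (sigma_of_family u).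

Let mixture_preimage (B : set T) :
  (fun t => u (idx t) t) @^-1` B =
  \big[setU/set0]_(k < K) (idx @^-1` [set k] `&` u k @^-1` B).
Proof.
rewrite -bigcup_seq; apply/seteqP; split => [t Bt|t [k _ [/= -> //]]].
by exists (idx t) => //=; rewrite mem_index_enum.
Qed.

Let measurable_mixture_part (B : set T) k :
  measurable B -> measurable (idx @^-1` [set k] `&` u k @^-1` B).
Proof.
move=> mB; apply: measurableI => //.
by rewrite -[X in measurable X]setTI; exact: measurable_funP.
Qed.

Lemma measurable_mixture : measurable_fun setT (fun t => u (idx t) t).
Proof.
move=> _ B mB; rewrite setTI mixture_preimage.
by apply: bigsetU_measurable => k _; exact: measurable_mixture_part.
Qed.

(** Splitting by the value of the index gives finitely many disjoint events, each factoring by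
    independence of [idx] from the family [u]. *)
Lemma mixture_law (B : set T) : measurable B ->
  P ((fun t => u (idx t) t) @^-1` B) = (\sum_(k < K) (p k)%:E * P (u k @^-1` B))%E.
Proof.
move=> mB; rewrite mixture_preimage measure_bigsetU_ord//; last 2 first.
- by move=> k; exact: measurable_mixture_part.
- by move=> i j _ _ [t [[/= <- _] [/= <- _]]].
apply: eq_bigr => k _; rewrite -idx_law; apply: idx_indep.
  by exists [set k] => //; rewrite setTI.
by apply: sub_sigma_algebra; exists k => //; exists B => //; rewrite setTI.
Qed.

End mixture.

(** * Density of the noisy mixture and its logarithmic gradient *)

Section gaussian_pdf_facts.
Context {R : realType} (n : nat).

Lemma gaussian_pdf_ge0 (M : 'M[R]_n) (y : 'cV[R]_n) :
  0 <= \det M -> 0 <= gaussian_pdf M y.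
Proof.
by move=> M0; rewrite !mulr_ge0 ?expR_ge0// exprn_ge0// invr_ge0 sqrtr_ge0.
Qed.

Lemma measurable_gaussian_pdf (M : 'M[R]_n) : measurable_fun setT (gaussian_pdf M).
Proof.
apply: measurable_funM => //; apply: measurableT_comp => //.
apply: measurable_funM => //.
apply: (@measurableT_comp _ _ _ _ _ _ (fun A : 'M[R]_1 => A ord0 ord0)).
  exact: measurable_entry.
have mM : measurable_fun setT (mulmx M : 'cV[R]_n -> 'cV[R]_n).
  exact: measurable_fun_mulmx.
by apply: measurable_fun_mulmx => //; exact: measurable_fun_trmx.
Qed.

End gaussian_pdf_facts.

Unset Implicit Arguments.
Set Strict Implicit.
Set Printing Implicit Defensive.

Theorem proposition1
  (R : realType) (d K : nat) (d_gt0 : (0 < d)%N) (K_gt0 : (0 < K)%N)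
  (sigma : R) (sigma_gt0 : 0 < sigma)
  (disp : measure_display) (Omega : measurableType disp)
  (P : probability Omega R)
  (Sigma : 'I_K -> 'M[R]_d) (Sigma_psd : forall k, psdmx (Sigma k))
  (u : 'I_K -> {RV P >-> 'cV[R]_d})
  (u_gaussian : forall k, is_gaussian P (Sigma k) (u k))
  (u_indep : mutually_indep P (fun k => sigma_of (u k)))
  (pi_ : 'I_K -> R) (pi_gt0 : forall k, 0 < pi_ k)
  (pi_sum : \sum_(k < K) pi_ k = 1)
  (idx : Omega -> 'I_K)
  (idx_measurable : forall k, measurable (idx @^-1` [set k]))
  (idx_law : forall k, P (idx @^-1` [set k]) = (pi_ k)%:E)
  (idx_indep : indep2 P (sigma_of_index idx) (sigma_of_family u))
  (z : Omega -> 'cV[R]_d) (z_def : z = fun omega => u (idx omega) omega)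
  (w : {RV P >-> 'cV[R]_d}) (w_gaussian : is_gaussian P 1%:M w)
  (w_indep_z : indep2 P (sigma_of w) (sigma_of z))
  (w_indep_idx : indep2 P (sigma_of w) (sigma_of_index idx))
  (q : 'cV[R]_d -> R)
  (q_density :
    is_continuous_density P (fun omega => z omega + sigma *: w omega) q)
  (M : 'I_K -> 'M[R]_d)
  (M_def : forall k, is_inv_sqrtmx (Sigma k + (sigma ^+ 2)%:M) (M k))
  (M_det : forall i j : 'I_K, (i <= j)%N ->
    pi_ i * \det (M i) = pi_ j * \det (M j))
  (x : 'cV[R]_d) :
  [/\ 0 < q x,
      differentiable (fun y => ln (q y)) x &
      gradient (fun y => ln (q y)) x =
      - (hconcat M
         *m (diag_mx
               (softmax (- 2^-1 *: \col_k norm2 ((M k)^T *m x) ^+ 2))^T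
             *t (1%:M : 'M[R]_d))
         *m vconcat (fun k => (M k)^T *m x))].
Proof.
have /choice[S SP] : forall k, exists S : 'M[R]_d, [/\ psdmx S, S *m S = Sigma k &
    forall A, measurable A -> P (u k @^-1` A) = std_gaussian (mulmx S @^-1` A)].
  by move=> k; exact: u_gaussian.
have /choice[T TP] : forall k, exists T : 'M[R]_d,
    [/\ pdmx T, T *m T = Sigma k + (sigma ^+ 2)%:M & M k = invmx T].
  by move=> k; exact: M_def.
have Ms k : (M k)^T = M k by have [[Ts _] _ ->] := TP k; rewrite trmx_inv Ts.
have M0 k : 0 < \det (M k).
  by have [pT _ ->] := TP k; rewrite det_inv invr_gt0 pdmx_det_gt0.
(* Index 0 lies below every index, so [M_det], stated for [i <= j], compares every weight with that
   of [k0]. *)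
pose k0 := Ordinal K_gt0.
have Mk k : pi_ k * \det (M k) = pi_ k0 * \det (M k0) by apply/esym/M_det.
pose f y := \sum_(k < K) pi_ k * gaussian_pdf (M k) y.
pose a := (Num.sqrt (2 * pi))^-1 ^+ d * (pi_ k0 * \det (M k0)).
have a0 : 0 < a.
  by rewrite !mulr_gt0// exprn_gt0// invr_gt0 sqrtr_gt0 mulr_gt0// trigo.pi_gt0.
have fE : f = fun y => a * \sum_(k < K)
    expR (- 2^-1 * ((M k *m y)^T *m (M k *m y)) ord0 ord0).
  apply/funext => y; rewrite mulr_sumr; apply: eq_bigr => k _.
  by rewrite /gaussian_pdf /a -(Mk k) !mulrA (mulrC (pi_ k)).
have [fx0 cf df gf] := gradient_log_sum x K_gt0 a0 fE.
have f0 y : 0 <= f y.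
  by apply: sumr_ge0 => k _; rewrite mulr_ge0 ?gaussian_pdf_ge0// ltW.
have mz : measurable_fun setT z.
  by rewrite z_def; exact: measurable_mixture.
pose Z : {RV P >-> 'cV[R]_d} := HB.pack z (isMeasurableFun.Build _ _ _ _ z mz).
have PE A : measurable A -> P ((fun t => z t + sigma *: w t) @^-1` A) =
    (\int[lebesgue_cV d]_(y in A) (f y)%:E)%E.
  move=> mA; pose E := [set v : 'cV[R]_d * 'cV[R]_d | A (v.1 + sigma *: v.2)].
  have mE : measurable E by exact: measurable_affine_pair.
  have uwE k : (distribution P (u k) \x^ distribution P w)%E E =
      (\int[lebesgue_cV d]_(y in A) (gaussian_pdf (M k) y)%:E)%E.
    have [[Ss _] SS uE] := SP k; have [pT TT ->] := TP k.
    rewrite -product_measure12//; apply: (gaussian_convolution (S := S k)) => //.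
    by rewrite SS.
  (* With [\x^] the variable [w] is integrated last, so each section is an event about [z] alone, to
     which [mixture_law] applies. *)
  transitivity ((distribution P Z \x^ distribution P w)%E E).
    by rewrite -product_measure12// -indep2_law.
  transitivity (\sum_(k < K) (pi_ k)%:E *
      (distribution P (u k) \x^ distribution P w)%E E)%E.
    rewrite /product_measure2.
    transitivity (\int[distribution P w]_y (\sum_(k < K) (pi_ k)%:E *
        (distribution P (u k)) (ysection E y)))%E.
      apply: eq_integral => y _.
      transitivity (P ((fun t => u (idx t) t) @^-1` ysection E y)).
        by rewrite -z_def.
      by apply: mixture_law => //; exact: measurable_ysection.
    rewrite ge0_integral_sum//; last 2 first.
    - by move=> k; apply: measurable_funeM; exact: measurable_fun_ysection.
    - by move=> k y _; rewrite mule_ge0// lee_fin ltW.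
    apply: eq_bigr => k _; rewrite ge0_integralZl//; last by rewrite lee_fin ltW.
    exact: measurable_fun_ysection.
  under eq_integral do rewrite -sumEFin.
  have mpdf k : measurable_fun A (fun y => (gaussian_pdf (M k) y)%:E).
    apply: measurable_funTS; apply/measurable_EFinP; exact: measurable_gaussian_pdf.
  rewrite ge0_integral_sum//; last 2 first.
  - move=> k; under eq_fun do rewrite EFinM.
    exact: measurable_funeM.
  - by move=> k y _; rewrite lee_fin mulr_ge0 ?gaussian_pdf_ge0// ltW.
  apply: eq_bigr => k _; rewrite uwE -ge0_integralZl//; last 2 first.
  - by move=> y _; rewrite lee_fin gaussian_pdf_ge0// ltW.
  - by rewrite lee_fin ltW.
have [cq q0 qE] := q_density.
(* Both are continuous densities of the same law, hence equal at every point, which transfers the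
   gradient of [ln f] to [q]. *)
have -> : q = f.
  by apply: continuous_density_unique => // A mA; rewrite -qE// PE.
split => //; rewrite gf hconcat_diag_vconcat; congr (- _); apply: eq_bigr => k _.
have EE i : expR (- 2^-1 * ((M i *m x)^T *m (M i *m x)) ord0 ord0) =
    expR ((- 2^-1 *: \col_k norm2 ((M k)^T *m x) ^+ 2) i ord0).
  by rewrite trmx_mul_norm2E !mxE Ms.
rewrite [softmax _ _ _]mxE EE; under eq_bigr do rewrite EE.
by rewrite Ms.
Qed.
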